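(* Let $p$ be an odd prime, $n$ a positive integer, and let $F:\mathbb{F}_{p^n}\to\mathbb{F}_{p^n}$ be an odd function (i.e. $F(-X)=-F(X)$ for all $X\in\mathbb{F}_{p^n}$) or an even function (i.e. $F(-X)=F(X)$ for all $X\in\mathbb{F}_{p^n}$). If the differential uniformity $\Delta_F$ of $F$ is strictly greater than $2$, then the second-order zero differential uniformity $\nabla_F$ of $F$ is not equal to $1$. In other words, if $\nabla_F=1$, then $F$ is an APN function over $\mathbb{F}_{p^n}$.
   Context: For $F:\mathbb{F}_{q}\to\mathbb{F}_{q}$ with $q=p^n$ and $a,b\in\mathbb{F}_q$, let $\Delta_F(a,b)$ be the number of $X\in\mathbb{F}_q$ with $F(X+a)-F(X)=b$. The differential uniformity is $\Delta_F=\max\{\Delta_F(a,b): a\in\mathbb{F}_q\setminus\{0\},\ b\in\mathbb{F}_q\}$. $F$ is almost perfect nonlinear (APN) if $\Delta_F=2$. For $a,b\in\mathbb{F}_q$ set $\nabla_F(a,b)=\#\{X\in\mathbb{F}_q: F(X+a+b)-F(X+b)-F(X+a)+F(X)=0\}$. For $p$ odd, the second-order zero differential uniformity of $F$ is $\nabla_F=\max\{\nabla_F(a,b): a,b\in\mathbb{F}_q\setminus\{0\}\}$. *)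

(* Defs.v *)
From mathcomp Require Import all_boot all_order all_algebra.

Set Implicit Arguments.
Unset Strict Implicit.
Unset Printing Implicit Defensive.

Import GRing.Theory.
Local Open Scope ring_scope.

Section Uniformity.

Variable K : finFieldType.
Implicit Types (F : K -> K) (a b : K).

Definition odd_fun F := forall X, F (- X) = - F X.

Definition even_fun F := forall X, F (- X) = F X.

Definition diff_count F a b : nat :=
  #|[set X : K | F (X + a) - F X == b]|.

Definition diff_uniformity F : nat :=
  (\max_(a : K | a != 0%R) \max_(b : K) diff_count F a b)%N.

Definition APN F := diff_uniformity F = 2%N.

Definition second_order_count F a b : nat :=
  #|[set X : K | F (X + a + b) - F (X + b) - F (X + a) + F X == 0]|.

(* Both directions range over nonzero elements only: this is the notion for
   odd characteristic. *)
Definition second_order_zero_uniformity F : nat :=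
  (\max_(a : K | a != 0%R) \max_(b : K | b != 0%R) second_order_count F a b)%N.

End Uniformity.

(* Main.v *)
(** The second-order difference of [F] in the directions [a], [b] vanishes at
    [X] iff it vanishes at [- X - a - b], whether [F] is odd or even. If
    [X <> Y] satisfy [F (X + a) - F X = F (Y + a) - F Y], then [X] is such a zero
    for [b = Y - X], and so is its reflection [- Y - a]. When these zeros are
    unique, [X + Y = - a]; so each solution of [F (X + a) - F X = c] determines
    the only other possible one, and there are at most two. *)
Require Import Defs.
From mathcomp Require Import all_boot all_order all_algebra.
From mathcomp Require Import ring.

Section SecondOrderZeros.

Import GRing.Theory.
Local Open Scope ring_scope.

Variables (K : finFieldType) (F : K -> K).
Implicit Types a b X Y : K.

Lemma diff_uniformity_leP m :
  reflect (forall a b, a != 0 -> (diff_count F a b <= m)%N)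
          (diff_uniformity F <= m)%N.
Proof.
apply: (iffP (bigmax_leqP _ _ _)) => [le_m a b a0 | le_m a a0].
  by have /bigmax_leqP := le_m a a0; apply.
by apply/bigmax_leqP => b _; apply: le_m.
Qed.

Lemma second_order_zero_uniformity_leP m :
  reflect (forall a b, a != 0 -> b != 0 -> (second_order_count F a b <= m)%N)
          (second_order_zero_uniformity F <= m)%N.
Proof.
apply: (iffP (bigmax_leqP _ _ _)) => [le_m a b a0 b0 | le_m a a0].
  by have /bigmax_leqP := le_m a a0; apply.
by apply/bigmax_leqP => b b0; apply: le_m.
Qed.

Lemma second_order_zeroE a X Y :
  (F (X + a + (Y - X)) - F (X + (Y - X)) - F (X + a) + F X == 0) =
  (F (X + a) - F X == F (Y + a) - F Y).
Proof.
have -> : X + a + (Y - X) = Y + a by ring.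
have -> : X + (Y - X) = Y by ring.
by rewrite [RHS]eq_sym -[RHS]subr_eq0 opprB addrA addrAC.
Qed.

(** The reflection [X |-> - X - a] exchanges the arguments [X] and [X + a] up to sign, so the
    difference in direction [a] is kept for odd [F] and negated for even [F]; equal differences stay
    equal either way. *)
Lemma diff_eq_reflect a X Y : odd_fun F \/ even_fun F ->
  F (X + a) - F X = F (Y + a) - F Y ->
  F (- Y - a + a) - F (- Y - a) = F (- X - a + a) - F (- X - a).
Proof.
rewrite !subrK -!opprD.
case=> FN; rewrite !FN => eqXY; last by rewrite -opprB -eqXY opprB.
by rewrite !opprK addrC -eqXY addrC.
Qed.

Lemma diff_eq_sum a X Y : odd_fun F \/ even_fun F ->
  (second_order_zero_uniformity F <= 1)%N -> a != 0 -> X != Y ->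
  F (X + a) - F X = F (Y + a) - F Y -> X + Y = - a.
Proof.
move=> F_parity /second_order_zero_uniformity_leP le1 a0 neqXY eqXY.
have c0 : Y - X != 0 by rewrite subr_eq0 eq_sym.
have /card_le1_eqP uniq_zero := le1 a (Y - X) a0 c0.
have -> : X = - Y - a; last by ring.
apply: uniq_zero; rewrite inE; last by rewrite second_order_zeroE eqXY.
(* Reflecting reverses the order of the pair: starting from [- Y - a], the second direction is again
   [Y - X], so both zeros are counted in the same set. *)
have -> : Y - X = (- X - a) - (- Y - a) by ring.
by rewrite second_order_zeroE; apply/eqP/diff_eq_reflect.
Qed.

Lemma diff_uniformity_le2 : odd_fun F \/ even_fun F ->
  (second_order_zero_uniformity F <= 1)%N -> (diff_uniformity F <= 2)%N.
Proof.
move=> F_parity le1; apply/diff_uniformity_leP => a b a0.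
rewrite leqNgt; apply/negP => /card_gt2P[X [Y [Z [[]]]]].
rewrite !inE => /eqP bX /eqP bY /eqP bZ [neqXY /negP neqYZ neqZX].
apply: neqYZ; apply/eqP/(addrI X).
rewrite eq_sym in neqZX.
have -> : X + Y = - a by apply: diff_eq_sum => //; rewrite bX bY.
by apply/esym/diff_eq_sum => //; rewrite bX bZ.
Qed.

(** This supplies the lower bound in APN. A second-order zero [X] in directions [a], [b] makes [X]
    and [X + b] two solutions of one difference equation, distinct since [b != 0]. *)
Lemma diff_uniformity_ge2 :
  (0 < second_order_zero_uniformity F)%N -> (1 < diff_uniformity F)%N.
Proof.
apply: contraTT; rewrite -!leqNgt => /diff_uniformity_leP le1.
apply/second_order_zero_uniformity_leP => a b a0 b0.
rewrite leqNgt; apply/negP => /card_gt0P[X]; rewrite inE.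
have -> : b = (X + b) - X by ring.
rewrite second_order_zeroE => /eqP eqX.
have /card_le1_eqP uniq_sol := le1 a (F (X + a) - F X) a0.
have /eqP : X + b = X by apply: uniq_sol; rewrite inE ?eqX.
by rewrite -subr_eq0 addrAC subrr add0r (negPf b0).
Qed.

End SecondOrderZeros.

Theorem theorem3p1 (p n : nat) (p_prime : prime p) (p_odd : odd p)
    (n_gt0 : 0 < n) (K : finFieldType) (cardK : #|K| = p ^ n)
    (F : K -> K) (F_odd_or_even : odd_fun F \/ even_fun F) :
  (2 < diff_uniformity F -> second_order_zero_uniformity F <> 1) /\
  (second_order_zero_uniformity F = 1 -> APN F).
Proof.
have le2 : second_order_zero_uniformity F = 1 -> diff_uniformity F <= 2.
  by move=> eq1; apply: diff_uniformity_le2; rewrite ?eq1.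
split=> [gt2 /le2 | eq1]; first by rewrite leqNgt gt2.
by apply/eqP; rewrite eqn_leq le2 // diff_uniformity_ge2 ?eq1.
Qed.
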